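(* Let $q\in(0,1)$, let $j_1,j_2\in\{0,\tfrac12,1,\tfrac32,\dots\}$, $j\in\{|j_1-j_2|,|j_1-j_2|+1,\dots,j_1+j_2\}$, $m_i\in\{-j_i,-j_i+1,\dots,j_i\}$ for $i=1,2$, and assume $m:=m_1+m_2$ satisfies $-j\le m\le j$. Then the Clebsch-Gordan coefficients of $su_q(2)$ satisfy the following three symmetry relations: $$\langle j_1m_1,j_2m_2|jm\rangle_q=(-1)^{j_2+m_2}\,q^{-m_2}\,\sqrt{\frac{[2j+1]_q}{[2j_1+1]_q}}\;\langle j_2\,{-m_2},j\,m|j_1m_1\rangle_{1/q},$$ $$\langle j_1m_1,j_2m_2|jm\rangle_q=(-1)^{j_1-m_1}\,q^{m_1}\,\sqrt{\frac{[2j+1]_q}{[2j_2+1]_q}}\;\langle j\,m,j_1\,{-m_1}|j_2m_2\rangle_{1/q},$$ $$\langle j_1m_1,j_2m_2|jm\rangle_q=(-1)^{j_1-m_1}\,q^{m_1}\,\sqrt{\frac{[2j+1]_q}{[2j_2+1]_q}}\;\langle j_1m_1,j\,{-m}|j_2\,{-m_2}\rangle_{1/q}.$$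
   Context: Notation. For real $q>0$, $q\ne1$: $[x]_q=\frac{q^x-q^{-x}}{q-q^{-1}}$ for $x\in\mathbb R$; $[0]_q!=1$ and $[n]_q!=[1]_q[2]_q\cdots[n]_q$ for $n\in\mathbb N$. Representations. For $j\in\{0,\frac12,1,\dots\}$, $D^j$ is the complex inner product space with orthonormal basis $|jm\rangle$, $m=-j,-j+1,\dots,j$, and operators $$J_0|jm\rangle=m|jm\rangle,\quad J_-|jm\rangle=\sqrt{[j+m]_q[j-m+1]_q}\,|j\,m-1\rangle,\quad J_+|jm\rangle=\sqrt{[j-m]_q[j+m+1]_q}\,|j\,m+1\rangle,$$ and $q^{aJ_0}|jm\rangle=q^{am}|jm\rangle$. On $D^{j_1}\otimes D^{j_2}$ (orthonormal basis $|j_1m_1\rangle|j_2m_2\rangle$) put $J_0(12)=J_0\otimes1+1\otimes J_0$ and $J_\pm(12)=J_\pm\otimes q^{J_0}+q^{-J_0}\otimes J_\pm$. Clebsch-Gordan coefficients. For $j\in\{|j_1-j_2|,\dots,j_1+j_2\}$ and $m\in\{-j,\dots,j\}$ let $$P^j_{mj}=\sqrt{\frac{[j+m]_q!}{[2j]_q!\,[j-m]_q!}}\sum_{r\ge0}\frac{(-1)^r[2j+1]_q!}{[r]_q!\,[2j+r+1]_q!}\,J_-(12)^{\,r+j-m}J_+(12)^{\,r}$$ (a finite sum, since $J_+(12)$ is nilpotent), and let $|j_1,j_2:jm\rangle$ be the unit vector $P^j_{mj}|j_1j_1\rangle|j_2\,j-j_1\rangle/\|P^j_{mj}|j_1j_1\rangle|j_2\,j-j_1\rangle\|$.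 For $m=m_1+m_2$, $\langle j_1m_1,j_2m_2|jm\rangle_q$ denotes the coefficient of $|j_1m_1\rangle|j_2m_2\rangle$ in $|j_1,j_2:jm\rangle$. The subscript indicates the base; $\langle\cdots\rangle_{1/q}$ is the same quantity with $q$ replaced by $1/q$ everywhere in the construction (in particular in the operators $J_\pm(12)$). *)

(* Defs.v *)
From mathcomp Require Import all_boot all_order all_algebra.
From mathcomp Require Import complex mxtens.
From mathcomp Require Import reals exp.

Set Implicit Arguments.
Unset Strict Implicit.
Unset Printing Implicit Defensive.

Import Order.TTheory GRing.Theory Num.Theory.

Local Open Scope ring_scope.
Local Open Scope complex_scope.

(* A spin j in {0, 1/2, 1, ...} is encoded by the natural number d = 2j, and a
   magnetic number m in {-j, ..., j} by the ordinal j + m : 'I_d.+1.  As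
   natural numbers, j + m is thus the ordinal m itself and j - m is d - m;
   the magnetic number -m is encoded by rev_ord m, and j by ord_max. *)

Section QuantumNumbers.
Variable R : realType.

Definition spin (d : nat) : R := d%:R / 2.

Definition mag d (m : 'I_d.+1) : R := m%:R - spin d.

Definition qnum (q x : R) : R := (q `^ x - q `^ (- x)) / (q - q^-1).

Definition qfact (q : R) (n : nat) : R := \prod_(1 <= i < n.+1) qnum q i%:R.

End QuantumNumbers.

(* j \in {|j1 - j2|, |j1 - j2| + 1, ..., j1 + j2}; the steps of 1 in j are
   steps of 2 in d = 2j, whence the parity condition. *)
Definition admissible (d1 d2 d : nat) : bool :=
  (`|d1 - d2|%N <= d <= d1 + d2)%N && (odd d == odd (d1 + d2)).

Section Representations.
Variables (R : realType) (q : R).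
Local Notation C := R[i].

(* Operators on D^j are given by their matrices in the basis |jm>, acting on
   column vectors: the entry (i, k) is the coefficient of |ji> in the image
   of |jk>. *)

Definition Jminus d : 'M[C]_d.+1 :=
  \matrix_(i, k) if i.+1 == k :> nat then
    (Num.sqrt (qnum q (spin R d + mag R k) * qnum q (spin R d - mag R k + 1)))%:C
  else 0.

Definition Jplus d : 'M[C]_d.+1 :=
  \matrix_(i, k) if i == k.+1 :> nat then
    (Num.sqrt (qnum q (spin R d - mag R k) * qnum q (spin R d + mag R k + 1)))%:C
  else 0.

(* q^{a J_0} *)
Definition qJ0 (a : R) d : 'M[C]_d.+1 :=
  diag_mx (\row_k (q `^ (a * mag R k))%:C).

Definition Jminus12 d1 d2 : 'M[C]_(d1.+1 * d2.+1) :=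
  tensmx (Jminus d1) (qJ0 1 d2) + tensmx (qJ0 (- 1) d1) (Jminus d2).

Definition Jplus12 d1 d2 : 'M[C]_(d1.+1 * d2.+1) :=
  tensmx (Jplus d1) (qJ0 1 d2) + tensmx (qJ0 (- 1) d1) (Jplus d2).

(* |j1 m1>|j2 m2> *)
Definition ket12 d1 d2 (m1 : 'I_d1.+1) (m2 : 'I_d2.+1) :
    'cV[C]_(d1.+1 * d2.+1) :=
  delta_mx (mxtens_index (m1, m2)) 0.

Definition vnorm n (v : 'cV[C]_n) : C := sqrtC (\sum_i `|v i 0| ^+ 2).

(* P^j_{mj}; the terms with r > 2(j1 + j2) vanish, see Jplus12_nilpotent. *)
Definition cgProj d1 d2 d (m : 'I_d.+1) : 'M[C]_(d1.+1 * d2.+1) :=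
  (Num.sqrt (qfact q m / (qfact q d * qfact q (d - m))))%:C *:
  \sum_(r < (d1 + d2).+1)
    ((-1) ^+ r * qfact q d.+1 / (qfact q r * qfact q (d + r).+1))%:C *:
      (Jminus12 d1 d2 ^+ (r + (d - m)) *m Jplus12 d1 d2 ^+ r).

(* P^j_{mj} |j1 j1>|j2 j-j1>; the magnetic number j - j1 of D^{j2} is encoded
   by j2 + j - j1 = (d2 + d - d1)./2. *)
Definition cgVec0 d1 d2 d (m : 'I_d.+1) : 'cV[C]_(d1.+1 * d2.+1) :=
  cgProj d1 d2 m *m ket12 ord_max (inord (d2 + d - d1)./2).

(* |j1, j2 : jm> *)
Definition cgVec d1 d2 d (m : 'I_d.+1) : 'cV[C]_(d1.+1 * d2.+1) :=
  (vnorm (cgVec0 d1 d2 m))^-1 *: cgVec0 d1 d2 m.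

(* <j1 m1, j2 m2 | j m>_q *)
Definition cg d1 d2 d (m1 : 'I_d1.+1) (m2 : 'I_d2.+1) (m : 'I_d.+1) : C :=
  cgVec d1 d2 m (mxtens_index (m1, m2)) 0.

Lemma Jplus12_exp_eq0 d1 d2 r (i1 k1 : 'I_d1.+1) (i2 k2 : 'I_d2.+1) :
  (i1 + i2 != k1 + k2 + r)%N ->
  (Jplus12 d1 d2 ^+ r) (mxtens_index (i1, i2)) (mxtens_index (k1, k2)) = 0.
Proof.
elim: r i1 i2 => [|r IHr] i1 i2 Hne.
  rewrite expr0 mxE; case: eqP => // /(can_inj (@mxtens_indexK _ _)) [E1 E2].
  by rewrite E1 E2 addn0 eqxx in Hne.
rewrite exprS mxE big1 // => l _.
case: (mxtens_indexP l) => l1 l2.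
have [E|/IHr->] := eqVneq (l1 + l2)%N (k1 + k2 + r)%N; last by rewrite mulr0.
suff -> : Jplus12 d1 d2 (mxtens_index (i1, i2)) (mxtens_index (l1, l2)) = 0.
  by rewrite mul0r.
rewrite mxE !tensmxE !mxE.
rewrite addnS -E in Hne.
have -> : (if i1 == l1.+1 :> nat then
    (Num.sqrt (qnum q (spin R d1 - mag R l1) *
      qnum q (spin R d1 + mag R l1 + 1)))%:C else 0) *
    ((q `^ (1 * mag R i2))%:C *+ (i2 == l2)) = 0 :> C.
  case: eqP => H1; last by rewrite mul0r.
  case: eqP => H2; last by rewrite mulr0.
  by move: Hne; rewrite H1 H2 addSn eqxx.
case: eqP => H1; last by rewrite mul0r addr0.
case: eqP => H2; last by rewrite mulr0 addr0.
by move: Hne; rewrite H1 H2 addnS eqxx.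
Qed.

Lemma Jplus12_nilpotent d1 d2 r : (d1 + d2 < r)%N -> Jplus12 d1 d2 ^+ r = 0.
Proof.
move=> Hr; apply/matrixP => i k; rewrite [RHS]mxE.
case: (mxtens_indexP i) => i1 i2; case: (mxtens_indexP k) => k1 k2.
apply: Jplus12_exp_eq0; rewrite neq_ltn (leq_ltn_trans (n := d1 + d2)) //.
  by apply: leq_add; rewrite -ltnS.
by apply: (leq_trans Hr); rewrite leq_addl.
Qed.

End Representations.

(* Main.v *)
Require Import Defs.
From mathcomp Require Import all_boot all_order all_algebra.
From mathcomp Require Import complex mxtens.
From mathcomp Require Import reals exp.
From mathcomp Require Import zify ring lra.

(* As a function of (m1, m2, m), the coefficient <j1 m1, j2 m2|j m>_q satisfies
   the three-term recurrences expressing that |jm> |-> |j1, j2 : jm> commutes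
   with J_- and J_+. These recurrences determine it up to a scalar: J_+|jj> = 0
   fixes the coefficients at m = j from the one at m1 = j1, and J_- then gives
   those with m < j. Multiplying by (-1)^(j1-m1) q^(m1) turns the recurrences of
   <j m, j1 -m1|j2 m2>_{1/q} and of <j1 m1, j -m|j2 -m2>_{1/q} into those of
   <j1 m1, j2 m2|j m>_q. The scalar is positive, since all three families are
   positive at m1 = j1, m = j, and its square [2j+1]/[2j2+1] is found by summing
   q^(-2m) times the squared coefficients over all (m1, m2, m) in two ways. *)

Set Implicit Arguments.
Unset Strict Implicit.
Unset Printing Implicit Defensive.

Import Order.TTheory GRing.Theory Num.Theory.

Local Open Scope ring_scope.

(** * q-numbers *)

Section QuantumScalars.
Variables (R : realType) (q : R).

(* For z = j + m: q^m, and the matrix element sqrt([j+m]_q [j-m+1]_q) of J_-. *)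
Definition qwt (d : nat) (z : int) : R := q `^ (z%:~R - spin R d).

Definition qcoef (d : nat) (z : int) : R :=
  Num.sqrt (qnum q z%:~R * qnum q (d%:Z - z + 1)%:~R).

End QuantumScalars.

Section QuantumScalarsTheory.
Variables (R : realType) (q : R).
Hypotheses (q_gt0 : 0 < q) (q_neq1 : q != 1).

Let q_neq0 : q != 0. Proof. by rewrite gt_eqF. Qed.

Lemma subr_qV_neq0 : q - q^-1 != 0.
Proof.
rewrite subr_eq0; apply/eqP => qV; case/negP: q_neq1.
have /eqP : q ^+ 2 = 1 by rewrite expr2 {2}qV mulfV.
by rewrite sqrf_eq1 => /orP[//|/eqP qN]; move: q_gt0; rewrite qN; lra.
Qed.

Lemma qnum_int (z : int) : qnum q z%:~R = (q ^ z - q ^ (- z)) / (q - q^-1).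
Proof. by rewrite /qnum -intrN !powR_intmul // ltW. Qed.

Lemma qnum0 : qnum q 0 = 0.
Proof. by rewrite /qnum oppr0 subrr mul0r. Qed.

Lemma qnumV x : qnum q^-1 x = qnum q x.
Proof.
rewrite /qnum invrK.
have qVpow y : q^-1 `^ y = q `^ (- y) by rewrite -powR_inv1 ?ltW // -powRrM mulN1r.
by rewrite !qVpow opprK -(opprB q q^-1) invrN mulrN -mulNr opprB.

Qed.

Lemma qcoefV : qcoef q^-1 =2 qcoef q.
Proof. by move=> d z; rewrite /qcoef !qnumV. Qed.

Lemma qwtV d z : qwt q^-1 d z = (qwt q d z)^-1.
Proof. by rewrite /qwt -powR_inv1 ?ltW // -powRrM mulN1r powRN. Qed.

Lemma qwt_gt0 d z : 0 < qwt q d z. Proof. exact: powR_gt0. Qed.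

Lemma qwt_neq0 d z : qwt q d z != 0. Proof. by rewrite gt_eqF ?qwt_gt0. Qed.

Lemma qwtD d (z a : int) : qwt q d (z + a) = q ^ a * qwt q d z.
Proof.
rewrite /qwt intrD addrAC powRD ?q_neq0 ?implybT // powR_intmul ?ltW //.
by rewrite mulrC.
Qed.

Lemma qwt_sqr d z : qwt q d z ^+ 2 = q ^ (z *+ 2 - d%:Z).
Proof.
rewrite -powR_mulrn ?powR_ge0 // -powRrM -powR_intmul ?ltW //; congr (_ `^ _).
by rewrite mulr2n intrB intrD /spin -pmulrn; field.
Qed.

(** The hypothesis is m1 + m2 = m for the shifted indices, doubled so as to stay within the
    integers; the conclusion is q^(m1) q^(m2) = q^m. *)
Lemma qwtM d1 d2 d (i k l : int) : (i + k) *+ 2 + d%:Z = l *+ 2 + (d1%:Z + d2%:Z) ->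
  qwt q d1 i * qwt q d2 k = qwt q d l.
Proof.
rewrite !mulr2n => ikl.
rewrite /qwt -powRD ?q_neq0 ?implybT //; congr (_ `^ _).
have /(congr1 (fun z : int => z%:~R : R)) := ikl.
by rewrite /spin !intrD -!pmulrn => e; lra.
Qed.

Lemma qwt_rev d (z : int) : qwt q d (d%:Z - z) = (qwt q d z)^-1.
Proof.
rewrite /qwt -powRN; congr (_ `^ _).
by rewrite intrB /spin -pmulrn; lra.
Qed.

(** The q-dimension: the trace of q^(-2 J_0) on the representation of dimension n is [n]_q. This is
    the source of the ratio [2j+1]/[2j2+1] in the symmetry relations. *)
Lemma qnum_sum n :
  \sum_(l < n) (qwt q n.-1 l) ^- 2 = qnum q n%:R.
Proof.
case: n => [|n]; first by rewrite big_ord0 qnum0.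
under eq_bigr => l _ do rewrite qwt_sqr /=.
rewrite -[n.+1%:R]/(n.+1%:Z%:~R) qnum_int.
apply: (mulIf subr_qV_neq0); rewrite divfK ?subr_qV_neq0 // mulr_suml.
(* Chosen so that [f l.+1 - f l] is q^(n-2l) (q - 1/q), which makes the sum telescope. *)
pose f (l : nat) := - q ^ (n%:Z + 1 - l%:Z *+ 2).
rewrite (eq_bigr (fun l : 'I_n.+1 => f l.+1 - f l)); last first.
  move=> l _; rewrite /f opprK invr_expz.
  have -> : - (l%:Z *+ 2 - n%:Z) = n%:Z - l%:Z *+ 2 by ring.
  have -> : n%:Z + 1 - l.+1%:Z *+ 2 = (n%:Z - l%:Z *+ 2) + (-1) by lia.
  have -> : n%:Z + 1 - l%:Z *+ 2 = (n%:Z - l%:Z *+ 2) + 1 by lia.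
  by rewrite !expfzDr // expr1z exprN1; ring.
rewrite -(big_mkord xpredT (fun l => f l.+1 - f l)) telescope_sumr // /f opprK.
have -> : n%:Z + 1 - n.+1%:Z *+ 2 = - n.+1%:Z by lia.
have -> : n%:Z + 1 - 0%:Z *+ 2 = n.+1%:Z by lia.
by rewrite addrC.
Qed.

(** A sum of powers of q is positive, which treats q < 1 and q > 1 at once; both bases q and 1/q
    occur later. *)
Lemma qnum_gt0 n : (0 < n)%N -> 0 < qnum q n%:R.
Proof.
case: n => // n _; rewrite -qnum_sum big_ord_recl ltr_pwDl //.
  by rewrite invr_gt0 exprn_gt0 ?qwt_gt0.
by apply: sumr_ge0 => l _; rewrite invr_ge0 exprn_ge0 // ltW ?qwt_gt0.
Qed.

Lemma qnum_int_gt0 (z : int) : 0 < z -> 0 < qnum q z%:~R.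
Proof. by case: z => // n ?; exact: qnum_gt0. Qed.

Lemma qnum_int_ge0 (z : int) : 0 <= z -> 0 <= qnum q z%:~R.
Proof.
by rewrite le_eqVlt => /orP[/eqP<-|/qnum_int_gt0/ltW//]; rewrite qnum0.
Qed.

Lemma qfact_gt0 n : 0 < qfact q n.
Proof.
rewrite /qfact big_add1 big_mkord; apply: prodr_gt0 => i _.
exact: qnum_gt0.
Qed.

Lemma qcoef0 d : qcoef q d 0 = 0.
Proof. by rewrite /qcoef qnum0 mul0r sqrtr0. Qed.

(** The reflection m -> 1 - m exchanges the two factors under the root. It serves whenever a
    magnetic number is negated or counted from the top. *)
Lemma qcoef_rev d z : qcoef q d (d%:Z + 1 - z) = qcoef q d z.
Proof.
rewrite /qcoef; have -> : d%:Z - (d%:Z + 1 - z) + 1 = z by ring.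
by rewrite mulrC addrAC.
Qed.

Lemma qcoef_last d : qcoef q d (d%:Z + 1) = 0.
Proof. by rewrite -(qcoef_rev d) subrr qcoef0. Qed.

Lemma qcoef_gt0 d z : 1 <= z -> z <= d%:Z -> 0 < qcoef q d z.
Proof.
by move=> z1 zd; rewrite sqrtr_gt0 mulr_gt0 // qnum_int_gt0 //; lia.
Qed.

Lemma qcoef_sqr d z : 0 <= z -> z <= d%:Z + 1 ->
  qcoef q d z ^+ 2 = qnum q z%:~R * qnum q (d%:Z - z + 1)%:~R.
Proof.
by move=> z0 zd; rewrite sqr_sqrtr // mulr_ge0 // qnum_int_ge0 //; lia.
Qed.

(** The diagonal entry of J_+ J_- - J_- J_+ = [2 J_0]_q on a single D^j. *)
Lemma qcoef_sqrB d z : 0 <= z -> z <= d%:Z ->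
  qcoef q d z ^+ 2 - qcoef q d (z + 1) ^+ 2
  = (qwt q d z ^+ 2 - qwt q d z ^- 2) / (q - q^-1).
Proof.
move=> z0 zd; rewrite !qcoef_sqr; [|lia..].
rewrite !qwt_sqr !qnum_int.
have -> : d%:Z - (z + 1) + 1 = d%:Z - z by ring.
rewrite mulr2n !opprD ?opprK !expfzDr // -!invr_expz expr1z.
have := subr_qV_neq0.
set A := q ^ z; set B := q ^ d.
have A0 : A != 0 by exact: expfz_neq0.
have B0 : B != 0 by exact: expfz_neq0.
move: A B A0 B0 => A B A0 B0 qq.
have q21 : q * q - 1 != 0.
  apply: contraNneq qq => e; apply/eqP; apply: (mulfI q_neq0).
  by rewrite mulr0 mulrBr mulfV.
by field; rewrite q21 q_neq0 A0 B0.
Qed.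

(* The induction step for J_+ J_-^k on a vector of weight m, with x = 2m. *)
Lemma qnum_step (k x : int) :
  qnum q (k + 1)%:~R * qnum q (x - k)%:~R
  = qnum q k%:~R * qnum q (x - k + 1)%:~R + qnum q (x - k *+ 2)%:~R.
Proof.
rewrite mulr2n !qnum_int !opprD ?opprK !expfzDr // -!invr_expz expr1z.
have := subr_qV_neq0; set A := q ^ k; set B := q ^ x.
have A0 : A != 0 by exact: expfz_neq0.
have B0 : B != 0 by exact: expfz_neq0.
move: A B A0 B0 => A B A0 B0 qq.
have q21 : q * q - 1 != 0.
  apply: contraNneq qq => e; apply/eqP; apply: (mulfI q_neq0).
  by rewrite mulr0 mulrBr mulfV.
by field; rewrite q21 q_neq0 A0 B0.
Qed.

End QuantumScalarsTheory.

(** * Ladder operators on real coordinates *)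

Section Coordinates.
Variables (R : realType) (d1 d2 : nat).
Implicit Type v : 'cV[R]_(d1.+1 * d2.+1).

(* The coordinate of v at |j1, i - j1>|j2, k - j2>, extended by zero to all
   integers so that the action of the ladder operators has no boundary cases. *)
Definition tcoord v (i k : int) : R :=
  \sum_(x : 'I_d1.+1) \sum_(y : 'I_d2.+1)
    v (mxtens_index (x, y)) 0 *+ ((x%:Z == i) && (y%:Z == k)).

Lemma tcoord_ord v (x : 'I_d1.+1) (y : 'I_d2.+1) :
  tcoord v x y = v (mxtens_index (x, y)) 0.
Proof.
rewrite /tcoord (bigD1 x) //= (bigD1 y) //= !eqxx mulr1n.
rewrite big1 ?addr0 => [|z /negPf nz].
  rewrite big1 ?addr0 // => z /negPf nz; rewrite big1 // => t _.
  by rewrite eqz_nat (inj_eq val_inj) nz.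
by rewrite !eqz_nat (inj_eq val_inj z) nz andbF.
Qed.

Lemma tcoord_out v (i k : int) :
  ~~ ((0 <= i <= d1%:Z) && (0 <= k <= d2%:Z)) -> tcoord v i k = 0.
Proof.
move=> out; rewrite /tcoord big1 // => x _; rewrite big1 // => y _.
case: (x%:Z =P i) => [xi|//]; case: (y%:Z =P k) => [yk|//].
by have := ltn_ord x; have := ltn_ord y; lia.
Qed.

Lemma int_ord d (i : int) : 0 <= i <= d%:Z -> exists x : 'I_d.+1, i = x.
Proof.
case: i => // n; rewrite /= lez_nat -ltnS => n_lt.
by exists (Ordinal n_lt).
Qed.

Lemma tcoord_eq u v : tcoord u =2 tcoord v -> u = v.
Proof.
move=> uv; apply/colP => p; case: (mxtens_indexP p) => x y.
by rewrite -!tcoord_ord uv.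
Qed.

Lemma tcoordD u v i k : tcoord (u + v) i k = tcoord u i k + tcoord v i k.
Proof.
rewrite /tcoord -big_split; apply: eq_bigr => x _; rewrite -big_split.
by apply: eq_bigr => y _; rewrite mxE mulrnDl.
Qed.

Lemma tcoordZ a v i k : tcoord (a *: v) i k = a * tcoord v i k.
Proof.
rewrite /tcoord mulr_sumr; apply: eq_bigr => x _; rewrite mulr_sumr.
by apply: eq_bigr => y _; rewrite mxE mulrnAr.
Qed.

Lemma tcoord0 i k : tcoord 0 i k = 0.
Proof. by rewrite -(scale0r 0) tcoordZ mul0r. Qed.

(** The eigenspace of J_0(12) for s - j1 - j2; the weight is shifted in the same way as the
    coordinates. *)
Definition has_weight v (s : int) := forall i k : int, i + k != s -> tcoord v i k = 0.

Lemma has_weight_eq0 v s : has_weight v s -> d1%:Z + d2%:Z < s -> v = 0.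
Proof.
move=> wv s_big; apply: tcoord_eq => i k; rewrite tcoord0.
have [ik|] := eqVneq (i + k) s; last exact: wv.
by rewrite tcoord_out //; lia.
Qed.

Lemma has_weightZ a v s : has_weight v s -> has_weight (a *: v) s.
Proof. by move=> wv i k /wv e; rewrite tcoordZ e mulr0. Qed.

Lemma sum_mxtens (F : 'I_(d1.+1 * d2.+1) -> R) :
  \sum_p F p = \sum_x \sum_y F (mxtens_index (x, y)).
Proof.
rewrite pair_bigA /= (reindex (@mxtens_index d1.+1 d2.+1)) /=.
  by apply: eq_bigr => -[].
by exists (@mxtens_unindex _ _) => x _; rewrite ?mxtens_indexK ?mxtens_unindexK.
Qed.

End Coordinates.

(** * Real matrices of the ladder operators on the tensor product *)

Section Ladder.
Variables (R : realType) (q : R).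
Hypotheses (q_gt0 : 0 < q) (q_neq1 : q != 1).

Definition lowering d : 'M[R]_d.+1 :=
  \matrix_(i, k) if i.+1 == k :> nat then qcoef q d k else 0.

Definition lowering12 d1 d2 : 'M[R]_(d1.+1 * d2.+1) :=
  tensmx (lowering d1) (diag_mx (\row_k qwt q d2 k)) +
  tensmx (diag_mx (\row_k (qwt q d1 k)^-1)) (lowering d2).

(** The matrices are real and J_+(12) is the adjoint of J_-(12), so a transpose suffices;
    [Jplus12_real] confirms the agreement. *)
Definition raising12 d1 d2 := (lowering12 d1 d2)^T.

Lemma Jminus_real d : Jminus q d = map_mx (real_complex R) (lowering d).
Proof.
apply/matrixP => i k; rewrite !mxE; case: eqP => // _.
rewrite /qcoef /mag -pmulrn intrD intrB -!pmulrn /=.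
by congr (Num.sqrt (qnum q _ * qnum q _))%:C%C; rewrite /spin; field.
Qed.

Lemma Jplus_real d : Jplus q d = map_mx (real_complex R) (lowering d)^T.
Proof.
apply/matrixP => i k; rewrite !mxE eq_sym; case: eqP => // <-.
rewrite /qcoef mulrC /mag -pmulrn intrD intrB -!pmulrn /=.
congr (Num.sqrt (qnum q _ * qnum q _))%:C%C.
  by rewrite /spin -natr1; field.
by rewrite /spin -natr1; field.
Qed.

Lemma qJ01_real d :
  qJ0 q 1 d = map_mx (real_complex R) (diag_mx (\row_k qwt q d k)).
Proof.
rewrite map_diag_mx; congr diag_mx; apply/rowP => k.
by rewrite !mxE mul1r.
Qed.

Lemma qJ0N1_real d :
  qJ0 q (- 1) d = map_mx (real_complex R) (diag_mx (\row_k (qwt q d k)^-1)).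
Proof.
rewrite map_diag_mx; congr diag_mx; apply/rowP => k.
by rewrite !mxE mulN1r powRN.
Qed.

Lemma Jminus12_real d1 d2 :
  Jminus12 q d1 d2 = map_mx (real_complex R) (lowering12 d1 d2).
Proof. by rewrite map_mxD !map_mxT -!Jminus_real -qJ01_real -qJ0N1_real. Qed.

Lemma Jplus12_real d1 d2 :
  Jplus12 q d1 d2 = map_mx (real_complex R) (raising12 d1 d2).
Proof.
rewrite /raising12 linearD /= !trmx_tens !tr_diag_mx.
by rewrite map_mxD !map_mxT -!Jplus_real -qJ01_real -qJ0N1_real.
Qed.

Variables d1 d2 : nat.
Implicit Type v : 'cV[R]_(d1.+1 * d2.+1).
Local Notation Jm := (lowering12 d1 d2).
Local Notation Jp := (raising12 d1 d2).

(** Valid for all integers: when i or k is -1, a shifted coordinate may re-enter the range, but it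
    is multiplied by [qcoef] at 0, which vanishes. *)
Lemma tcoord_lowering v i k :
  tcoord (Jm *m v) i k =
    qwt q d2 k * qcoef q d1 (i + 1) * tcoord v (i + 1) k
    + (qwt q d1 i)^-1 * qcoef q d2 (k + 1) * tcoord v i (k + 1).
Proof.
have [/andP[/int_ord[x ->] /int_ord[y ->]]|out] :=
    boolP ((0 <= i <= d1%:Z) && (0 <= k <= d2%:Z)); last first.
  rewrite tcoord_out //.
  have [->|i_neq] := eqVneq i (-1).
    by rewrite addNr qcoef0 mulr0 mul0r tcoord_out ?mulr0 ?addr0 //; lia.
  have [->|k_neq] := eqVneq k (-1).
    by rewrite addNr qcoef0 mulr0 mul0r tcoord_out ?mulr0 ?addr0 //; lia.
  by rewrite !tcoord_out ?mulr0 ?addr0 //; lia.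
rewrite tcoord_ord mxE sum_mxtens /tcoord !mulr_sumr -big_split /=.
apply: eq_bigr => x' _; rewrite !mulr_sumr -big_split /=.
apply: eq_bigr => y' _; rewrite mxE !tensmxE !mxE mulrDl; congr (_ + _).
  rewrite (eq_sym x'%:Z) -PoszD addn1 !eqz_nat (eq_sym (y' : nat)).
  case: eqP => [->|_]; last by rewrite mul0r mul0r mulr0n mulr0.
  rewrite (inj_eq val_inj); case: eqP => [->|_] /=.
    by rewrite !mulr1n (mulrC (qcoef _ _ _)).
  by rewrite !mulr0n mulr0 mul0r mulr0.
rewrite (eq_sym y'%:Z) -PoszD addn1 !eqz_nat (eq_sym (x' : nat)).
rewrite (inj_eq val_inj x); case: eqP => [->|_] /=; last first.
  by rewrite !mulr0n !mul0r mulr0.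
case: eqP => [->|_]; last by rewrite mulr0 mul0r mulr0.
by rewrite !mulr1n.
Qed.

Lemma tcoord_raising v i k :
  tcoord (Jp *m v) i k =
    qwt q d2 k * qcoef q d1 i * tcoord v (i - 1) k
    + (qwt q d1 i)^-1 * qcoef q d2 k * tcoord v i (k - 1).
Proof.
have [/andP[/int_ord[x ->] /int_ord[y ->]]|out] :=
    boolP ((0 <= i <= d1%:Z) && (0 <= k <= d2%:Z)); last first.
  rewrite tcoord_out //.
  have [->|i_neq] := eqVneq i (d1%:Z + 1).
    by rewrite qcoef_last mulr0 mul0r tcoord_out ?mulr0 ?addr0 //; lia.
  have [->|k_neq] := eqVneq k (d2%:Z + 1).
    by rewrite qcoef_last mulr0 mul0r tcoord_out ?mulr0 ?addr0 //; lia.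
  by rewrite !tcoord_out ?mulr0 ?addr0 //; lia.
rewrite tcoord_ord mxE sum_mxtens /tcoord !mulr_sumr -big_split /=.
apply: eq_bigr => x' _; rewrite !mulr_sumr -big_split /=.
apply: eq_bigr => y' _; rewrite /raising12 mxE mxE !tensmxE !mxE mulrDl.
congr (_ + _).
  rewrite -(inj_eq (addIr 1)) subrK -PoszD addn1 !eqz_nat.
  case: eqP => [<-|_]; last by rewrite mul0r mul0r mulr0n mulr0.
  rewrite (inj_eq val_inj); case: eqP => [<-|_] /=.
    by rewrite !mulr1n (mulrC (qcoef _ _ _)).
  by rewrite !mulr0n mulr0 mul0r mulr0.
rewrite -(inj_eq (addIr 1) y'%:Z) subrK -PoszD addn1 !eqz_nat.
rewrite (inj_eq val_inj x'); case: eqP => [<-|_] /=; last first.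
  by rewrite !mulr0n !mul0r mulr0.
case: eqP => [<-|_]; last by rewrite mulr0 mul0r mulr0.
by rewrite !mulr1n.
Qed.

End Ladder.

(** * Highest weight vectors and the extremal projector *)

Section HighestWeight.
Variables (R : realType) (q : R).
Hypotheses (q_gt0 : 0 < q) (q_neq1 : q != 1).
Variables d1 d2 : nat.
Implicit Type u v w : 'cV[R]_(d1.+1 * d2.+1).
Local Notation Jm := (lowering12 q d1 d2).
Local Notation Jp := (raising12 q d1 d2).

Lemma has_weight_sum n (F : nat -> 'cV[R]_(d1.+1 * d2.+1)) s :
  (forall r, has_weight (F r) s) -> has_weight (\sum_(r < n) F r) s.
Proof.
move=> wF; elim: n => [|n IHn] i k ik; first by rewrite big_ord0 tcoord0.
by rewrite big_ord_recr tcoordD IHn // wF // addr0.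
Qed.

Lemma has_weight_lowering v s : has_weight v s -> has_weight (Jm *m v) (s - 1).
Proof.
by move=> wv i k ik; rewrite tcoord_lowering // !wv ?mulr0 ?addr0 //; lia.
Qed.

Lemma has_weight_raising v s : has_weight v s -> has_weight (Jp *m v) (s + 1).
Proof.
by move=> wv i k ik; rewrite tcoord_raising // !wv ?mulr0 ?addr0 //; lia.
Qed.

Lemma lowering_expS r v : Jm ^+ r.+1 *m v = Jm *m (Jm ^+ r *m v).
Proof. by rewrite exprS -mulmxA. Qed.

Lemma raising_expS r v : Jp ^+ r.+1 *m v = Jp *m (Jp ^+ r *m v).
Proof. by rewrite exprS -mulmxA. Qed.

Lemma has_weight_lowering_exp v s r :
  has_weight v s -> has_weight (Jm ^+ r *m v) (s - r%:Z).
Proof.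
move=> wv; elim: r => [|r IHr]; first by rewrite expr0 mul1mx subr0.
rewrite lowering_expS; have -> : s - r.+1%:Z = s - r%:Z - 1 by lia.
exact: has_weight_lowering.
Qed.

Lemma has_weight_raising_exp v s r :
  has_weight v s -> has_weight (Jp ^+ r *m v) (s + r%:Z).
Proof.
move=> wv; elim: r => [|r IHr]; first by rewrite expr0 mul1mx addr0.
rewrite raising_expS; have -> : s + r.+1%:Z = s + r%:Z + 1 by lia.
exact: has_weight_raising.
Qed.

(** The relation [J_+, J_-] = [2 J_0] survives the coproduct: the mixed terms cancel, and the
    diagonal ones add up by q^(2 m2) [2 m1] + q^(-2 m1) [2 m2] = [2 m1 + 2 m2]. *)
Lemma ladder_comm v s : has_weight v s ->
  Jp *m (Jm *m v)
  = Jm *m (Jp *m v) + qnum q (s *+ 2 - (d1%:Z + d2%:Z))%:~R *: v.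
Proof.
move=> wv; apply: tcoord_eq => i k; rewrite tcoordD tcoordZ.
have [ik|out] := boolP ((0 <= i <= d1%:Z) && (0 <= k <= d2%:Z)); last first.
  by rewrite !(tcoord_out _ out) mulr0 addr0.
have diag : (qwt q d2 k ^+ 2 * (qcoef q d1 i ^+ 2 - qcoef q d1 (i + 1) ^+ 2)
    + qwt q d1 i ^- 2 * (qcoef q d2 k ^+ 2 - qcoef q d2 (k + 1) ^+ 2))
      * tcoord v i k
    = qnum q (s *+ 2 - (d1%:Z + d2%:Z))%:~R * tcoord v i k.
  have [sE|/wv->] := eqVneq (i + k) s; last by rewrite !mulr0.
  congr (_ * _); rewrite !qcoef_sqrB //; [|lia..].
  have -> : s *+ 2 - (d1%:Z + d2%:Z) = (i *+ 2 - d1%:Z) + (k *+ 2 - d2%:Z).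
    by rewrite -sE !mulr2n; ring.
  rewrite qnum_int // !qwt_sqr //.
  move: (i *+ 2 - _) (k *+ 2 - _) => x y.
  rewrite opprD !expfzDr ?gt_eqF // -!invr_expz.
  have q0 : q != 0 by rewrite gt_eqF.
  have := expfz_neq0 x q0; have := expfz_neq0 y q0.
  have := subr_qV_neq0 q_gt0 q_neq1.
  move: (q - q^-1) (q ^ x) (q ^ y) => z X Y z0 Y0 X0.
  by field; rewrite z0 Y0 X0.
rewrite !(tcoord_raising, tcoord_lowering) // !subrK !addrK !qwtD //.
rewrite expr1z exprN1.
have := qwt_neq0 q_gt0 d1 i; have : q != 0 by rewrite gt_eqF.
set a1 := qcoef q d1 i in diag *; set b1 := qcoef q d1 (i + 1) in diag *.
set a2 := qcoef q d2 k in diag *; set b2 := qcoef q d2 (k + 1) in diag *.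
set x := qwt q d1 i in diag *; set y := qwt q d2 k in diag *.
set N := qnum q _ in diag *.
move: (tcoord v _ _) (tcoord v _ _) (tcoord v _ _) diag => V V1 V2.
move: a1 a2 b1 b2 x y N => a1 a2 b1 b2 x y N diag q0 x0.
rewrite -diag; field; by rewrite q0 x0.
Qed.

(** Induction on r: each commutation past one more J_- adds a term given by [ladder_comm], and
    [qnum_step] absorbs it into the product. For r = 0 the factor [0] = 0 neutralizes the truncated
    [r.-1]. *)
Lemma raising_lowering_exp v s r : has_weight v s ->
  Jp *m (Jm ^+ r *m v)
  = Jm ^+ r *m (Jp *m v)
    + (qnum q r%:Z%:~R * qnum q (s *+ 2 - (d1%:Z + d2%:Z) - r%:Z + 1)%:~R)
      *: (Jm ^+ r.-1 *m v).
Proof.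
move=> wv; elim: r => [|r IHr].
  by rewrite !expr0 !mul1mx qnum0 mul0r scale0r addr0.
rewrite !lowering_expS (ladder_comm (has_weight_lowering_exp wv)) IHr.
rewrite mulmxDr -addrA -scalemxAr; congr (_ + _) => /=.
pose x := s *+ 2 - (d1%:Z + d2%:Z); rewrite -/x.
have -> : (s - r%:Z) *+ 2 - (d1%:Z + d2%:Z) = x - r%:Z *+ 2.
  by rewrite /x !mulr2n; ring.
have -> : x - r.+1%:Z + 1 = x - r%:Z by lia.
have -> : r.+1%:Z = r%:Z + 1 by lia.
rewrite (qnum_step q_gt0 q_neq1 r x) scalerDl; apply: (congr1 (+%R^~ _)).
case: r {IHr} => [|r]; first by rewrite qnum0 !mul0r !scale0r.
by rewrite -lowering_expS.
Qed.

Definition projector_coef d r : R :=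
  (-1) ^+ r * qfact q d.+1 / (qfact q r * qfact q (d + r).+1).

(** The extremal projector P^j_{jj} applied to v; P^j_{mj} is a positive multiple of J_-^(j-m)
    P^j_{jj}. *)
Definition projector d v : 'cV[R]_(d1.+1 * d2.+1) :=
  \sum_(r < (d1 + d2).+1) projector_coef d r *: (Jm ^+ r *m (Jp ^+ r *m v)).

Lemma qfactS n : qfact q n.+1 = qfact q n * qnum q n.+1%:Z%:~R.
Proof. by rewrite /qfact big_nat_recr. Qed.

Lemma projector_coef0 d : projector_coef d 0 = 1.
Proof.
rewrite /projector_coef addn0 expr0 mul1r {2}/qfact big_geq // mul1r divff //.
by rewrite gt_eqF ?qfact_gt0.
Qed.

(** This ratio of consecutive coefficients is exactly what makes J_+ P^j_{jj} telescope on vectors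
    of magnetic number j. *)
Lemma projector_coefS d r :
  projector_coef d r.+1 * (qnum q r.+1%:Z%:~R * qnum q (d + r).+2%:Z%:~R)
  = - projector_coef d r.
Proof.
rewrite /projector_coef addnS !(qfactS r) (qfactS (d + r).+1).
rewrite exprS mulN1r.
have := qnum_gt0 q_gt0 q_neq1 (ltn0Sn r); rewrite pmulrn => /lt0r_neq0.
have := qnum_gt0 q_gt0 q_neq1 (ltn0Sn (d + r).+1); rewrite pmulrn => /lt0r_neq0.
have /lt0r_neq0 := qfact_gt0 q_gt0 q_neq1 r.
have /lt0r_neq0 := qfact_gt0 q_gt0 q_neq1 (d + r).+1.
set x := qfact q r; set y := qfact q (d + r).+1.
set a := qnum q _; set b := qnum q _; set c := qfact q _.
set e := _ ^+ r; move: a b c e x y => a b c e x y y0 x0 b0 a0.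
by field; rewrite x0 y0 a0 b0.
Qed.

Lemma has_weight_projector d v s :
  has_weight v s -> has_weight (projector d v) s.
Proof.
move=> wv; pose F r := projector_coef d r *: (Jm ^+ r *m (Jp ^+ r *m v)).
apply: (@has_weight_sum _ F) => r; apply: has_weightZ.
rewrite -[s](addrK r%:Z).
by apply: has_weight_lowering_exp; apply: has_weight_raising_exp.
Qed.

(** By [raising_lowering_exp], J_+ turns the r-th summand into [T r - T r.-1] (just [T 0] for r =
    0). Only the last [T] survives, and its power of J_+ pushes v beyond the highest weight. *)
Lemma raising_projector d v s : has_weight v s ->
  s *+ 2 = d1%:Z + d2%:Z + d%:Z -> Jp *m projector d v = 0.
Proof.
move=> wv sE; rewrite mulmx_sumr.
pose T r := projector_coef d r *: (Jm ^+ r *m (Jp ^+ r.+1 *m v)).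
pose G r := if r is r'.+1 then T r' else 0.
rewrite (eq_bigr (fun r : 'I__ => G r.+1 - G r)); last first.
  move=> r _; rewrite -scalemxAr.
  rewrite (raising_lowering_exp _ (has_weight_raising_exp wv)).
  rewrite scalerDr /= -raising_expS; congr (_ + _).
  case: (nat_of_ord r) => [|n] /=.
    by rewrite qnum0 mul0r scale0r scaler0 oppr0.
  rewrite scalerA /T -scaleNr; congr (_ *: _).
  rewrite -projector_coefS; congr (_ * (_ * qnum q _%:~R)).
  by rewrite mulrnDl sE !mulr2n; lia.
rewrite -(big_mkord xpredT (fun r => G r.+1 - G r)) telescope_sumr // subr0 /=.
rewrite /T (has_weight_eq0 (has_weight_raising_exp (r := (d1 + d2).+1) wv)).
  by rewrite mulmx0 scaler0.
by move: sE; rewrite mulr2n; lia.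
Qed.

Definition dot u v : R := \sum_p u p 0 * v p 0.

Lemma dotE u v : dot u v = (u^T *m v) 0 0.
Proof. by rewrite mxE; apply: eq_bigr => p _; rewrite mxE. Qed.

Lemma dotC u v : dot u v = dot v u.
Proof. by apply: eq_bigr => p _; rewrite mulrC. Qed.

Lemma dot_ge0 v : 0 <= dot v v.
Proof. by apply: sumr_ge0 => p _; rewrite -expr2 sqr_ge0. Qed.

Lemma dot_eq0 v : dot v v = 0 -> v = 0.
Proof.
move/eqP; rewrite psumr_eq0 => [|p _]; last by rewrite -expr2 sqr_ge0.
move/allP => v0; apply/colP => p; rewrite mxE; apply/eqP.
by have := v0 p (mem_index_enum p); rewrite mulf_eq0 orbb.
Qed.

Lemma dotZr a u v : dot u (a *: v) = a * dot u v.
Proof. by rewrite /dot mulr_sumr; apply: eq_bigr => p _; rewrite mxE mulrCA. Qed.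

Lemma dotZl a u v : dot (a *: u) v = a * dot u v.
Proof. by rewrite dotC dotZr dotC. Qed.

Lemma dot_lowering u v : dot u (Jm *m v) = dot (Jp *m u) v.
Proof. by rewrite !dotE trmx_mul trmxK mulmxA. Qed.

(** A vector killed by J_+ is orthogonal to the image of J_-, where all terms with r > 0 lie; the
    term r = 0 has coefficient 1. *)
Lemma dot_projector d w v : Jp *m w = 0 -> dot w (projector d v) = dot w v.
Proof.
move=> w0; rewrite /projector big_ord_recl /=.
rewrite projector_coef0 // scale1r !expr0 !mul1mx dotE mulmxDr mxE -!dotE.
rewrite [X in _ + X](_ : _ = 0) ?addr0 // dotE mulmx_sumr summxE big1 // => r _.
by rewrite -dotE dotZr lowering_expS dot_lowering w0 dotE trmx0 mul0mx mxE mulr0.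
Qed.

(** Hence no nonzero multiple of the ket with m1 = j1 is a lowered vector. The vanishing entries
    with m1 < j1 kill the coordinates of y one by one, starting at m1 = -j1, where the second index
    t + 1 exceeds d2. *)
Lemma tcoord_lowering_top (t : int) y :
  d2%:Z <= t ->
  (forall i k : int, i + k = t -> i < d1%:Z -> tcoord (Jm *m y) i k = 0) ->
  tcoord (Jm *m y) d1 (t - d1%:Z) = 0.
Proof.
move=> d2t y0.
have {}y0 (n : nat) : (n <= d1)%N -> tcoord y n (t - n%:Z + 1) = 0.
  elim: n => [_|n IHn nd]; first by rewrite tcoord_out //; lia.
  have : tcoord (Jm *m y) n (t - n%:Z) = 0 by apply: y0; lia.
  rewrite tcoord_lowering // IHn 1?ltnW // mulr0 addr0 => /eqP.
  rewrite !mulf_eq0 gt_eqF ?qwt_gt0 // gt_eqF ?qcoef_gt0 //=; [|lia..].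
  have -> : t - n.+1%:Z + 1 = t - n%:Z by lia.
  have -> : n.+1%:Z = n%:Z + 1 by lia.
  by move/eqP.
by rewrite tcoord_lowering // qcoef_last mulr0 mul0r add0r y0 // mulr0.
Qed.

End HighestWeight.

(** * Recurrences, normalization and phase of the coefficients *)

Section RealCG.
Variables (R : realType) (q : R).
Hypotheses (q_gt0 : 0 < q) (q_neq1 : q != 1).

Definition ket_top d1 d2 d : 'cV[R]_(d1.+1 * d2.+1) :=
  delta_mx (mxtens_index (ord_max, inord (d2 + d - d1)./2)) 0.

Definition hwvec d1 d2 d := projector q d (ket_top d1 d2 d).

Definition cgvec d1 d2 d (l : nat) : 'cV[R]_(d1.+1 * d2.+1) :=
  let u := lowering12 q d1 d2 ^+ (d - l) *m hwvec d1 d2 d in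
  (Num.sqrt (dot u u))^-1 *: u.

(* The Clebsch-Gordan coefficients with magnetic numbers i - j1, k - j2, l - j
   for arbitrary integers i, k, l, extended by zero. *)
Definition cgR d1 d2 d (i k l : int) : R :=
  if 0 <= l <= d%:Z then tcoord (cgvec d1 d2 d `|l|) i k else 0.

Lemma vnorm_real n (v : 'cV[R]_n) :
  vnorm (map_mx (real_complex R) v) = (Num.sqrt (\sum_p v p 0 * v p 0))%:C%C.
Proof.
have v_ge0 : 0 <= \sum_p v p 0 * v p 0.
  by apply: sumr_ge0 => p _; rewrite -expr2 sqr_ge0.
rewrite /vnorm (_ : \sum_i _ = (Num.sqrt (\sum_p v p 0 * v p 0))%:C%C ^+ 2).
  by rewrite sqrCK // lecR sqrtr_ge0.
rewrite -rmorphXn sqr_sqrtr // rmorph_sum; apply: eq_bigr => p _ /=.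
rewrite mxE real_normK -?expr2 ?rmorphXn //.
by apply/complex_realP; eexists.
Qed.

Lemma cgVec0_real d1 d2 d (l : 'I_d.+1) :
  cgVec0 q d1 d2 l = map_mx (real_complex R)
    (Num.sqrt (qfact q l / (qfact q d * qfact q (d - l)))
     *: (lowering12 q d1 d2 ^+ (d - l) *m hwvec d1 d2 d)).
Proof.
rewrite /cgVec0 /cgProj /hwvec /projector -scalemxAl map_mxZ.
congr (_ *: _); rewrite mulmx_suml mulmx_sumr map_mx_sum.
apply: eq_bigr => r _; rewrite -scalemxAl -scalemxAr map_mxZ; congr (_ *: _).
rewrite Jminus12_real Jplus12_real -!rmorphXn /ket12.
rewrite -(map_delta_mx (real_complex R)) -!map_mxM /=; congr map_mx.
by rewrite addnC exprD -!mulmxA.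
Qed.

(** The prefactor of P^j_{mj} is positive and cancels in the normalization, so [cgvec] omits it. *)
Lemma cg_real d1 d2 d (x : 'I_d1.+1) (y : 'I_d2.+1) (l : 'I_d.+1) :
  cg q x y l = (cgR d1 d2 d x y l)%:C%C.
Proof.
have l_le : (l <= d)%N by rewrite -ltnS.
rewrite /cgR lez_nat l_le /= tcoord_ord.
rewrite /cg /cgVec cgVec0_real vnorm_real.
set s := Num.sqrt (_ / _); set u := _ *m _.
have s_gt0 : 0 < s.
  by rewrite sqrtr_gt0 divr_gt0 ?mulr_gt0 ?qfact_gt0.
rewrite /cgvec -/u -fmorphV -map_mxZ mxE; congr (_ %:C)%C.
rewrite scalerA [LHS]mxE [RHS]mxE; congr (_ * _).
rewrite -[\sum_p _]/(dot (s *: u) (s *: u)) dotZl dotZr mulrA -expr2.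
rewrite sqrtrM ?sqr_ge0 // sqrtr_sqr gtr0_norm // invfM.
by rewrite mulrAC mulVf ?mul1r // gt_eqF.
Qed.

(** * The multiplet of spin j, with [t] = j1 + j2 + j and the triangle inequalities as bounds by
    [t] *)

Variables d1 d2 d t : nat.
Hypotheses (tE : (d1 + d2 + d = t.*2)%N) (d1t : (d1 <= t)%N) (d2t : (d2 <= t)%N)
  (dt : (d <= t)%N).
Local Notation w := (hwvec d1 d2 d).
Local Notation Jm := (lowering12 q d1 d2).
Local Notation Jp := (raising12 q d1 d2).
Local Notation u r := (Jm ^+ r *m w).

Lemma tcoord_ket_top i k :
  tcoord (ket_top d1 d2 d) i k = ((i == d1%:Z) && (k == t%:Z - d1%:Z))%:R.
Proof.
have [/andP[/int_ord[x ->] /int_ord[y ->]]|out] :=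
    boolP ((0 <= i <= d1%:Z) && (0 <= k <= d2%:Z)); last first.
  by rewrite tcoord_out //; case: andP => // -[/eqP i_ /eqP k_]; lia.
rewrite tcoord_ord mxE eqxx andbT (can_eq (@mxtens_indexK _ _)).
rewrite xpair_eqE -!val_eqE /= inordK; last by rewrite ltnS; lia.
congr ((_ && _)%:R); apply/eqP/eqP; lia.
Qed.

Lemma has_weight_ket_top : has_weight (ket_top d1 d2 d) t.
Proof.
move=> i k ik; rewrite tcoord_ket_top.
by case: (i =P _) => [i_|//]; case: (k =P _) => [k_|//]; lia.
Qed.

Lemma dot_ket_top v : dot v (ket_top d1 d2 d) = tcoord v d1 (t%:Z - d1%:Z).
Proof.
have kt : (t - d1 < d2.+1)%N by lia.
have -> : t%:Z - d1%:Z = Ordinal kt by rewrite /=; lia.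
rewrite -[d1%:Z]/((@ord_max d1)%:Z) tcoord_ord /dot.
rewrite (bigD1 (mxtens_index (ord_max, Ordinal kt))) //= big1 => [|p /negPf np].
  rewrite mxE eqxx andbT addr0.
  case: eqP; first by rewrite mulr1.
  case; congr (mxtens_index (_, _)); apply: val_inj => /=.
  by rewrite inordK ?ltnS; lia.
rewrite mxE andbC /= (_ : inord _ = Ordinal kt) ?np ?mulr0 //.
by apply: val_inj => /=; rewrite inordK ?ltnS; lia.
Qed.

Lemma has_weight_hwvec : has_weight w t.
Proof. exact: has_weight_projector has_weight_ket_top. Qed.

Let tE' : t%:Z *+ 2 = d1%:Z + d2%:Z + d%:Z.
Proof. by rewrite mulr2n; lia. Qed.

Lemma raising_hwvec : Jp *m w = 0.
Proof. exact: raising_projector has_weight_ket_top tE'. Qed.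

(** The top coordinate of w is its squared norm; this fixes the phase of the coefficients. *)
Lemma dot_hwvec : dot w w = tcoord w d1 (t%:Z - d1%:Z).
Proof. by rewrite dot_projector ?raising_hwvec // dot_ket_top. Qed.

(* The projector is 1 modulo the image of J_-, so if it killed the top ket,
   that ket would be a lowered vector. *)
Lemma hwvec_neq0 : w != 0.
Proof.
apply/eqP => w0.
pose y := - \sum_(r < d1 + d2) projector_coef q d r.+1 *:
  (Jm ^+ r *m (Jp ^+ r.+1 *m ket_top d1 d2 d)).
have ketE : ket_top d1 d2 d = Jm *m y.
  apply/eqP; rewrite mulmxN -addr_eq0; apply/eqP; rewrite -[RHS]w0 /hwvec.
  rewrite /projector big_ord_recl projector_coef0 // scale1r !expr0 !mul1mx.
  congr (_ + _); rewrite mulmx_sumr; apply: eq_bigr => r _.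
  by rewrite -scalemxAr -lowering_expS.
have := tcoord_lowering_top q_gt0 q_neq1 (t := t) (y := y).
rewrite -ketE tcoord_ket_top !eqxx /= => top.
suff /eqP : 1 = 0 :> R by rewrite oner_eq0.
apply: top; first by rewrite lez_nat.
by move=> i k ik i_lt; rewrite tcoord_ket_top lt_eqF.
Qed.

Lemma raising_lowered r : (r <= d.+1)%N ->
  Jp *m u r = qcoef q d r ^+ 2 *: u r.-1.
Proof.
move=> rd; rewrite (raising_lowering_exp q_gt0 q_neq1 _ has_weight_hwvec) //.
rewrite raising_hwvec mulmx0 add0r qcoef_sqr //; [|lia..].
by congr ((_ * qnum q _%:~R) *: _); rewrite tE'; ring.
Qed.

Lemma dot_loweredS r : (r <= d)%N ->
  dot (u r.+1) (u r.+1) = qcoef q d r.+1 ^+ 2 * dot (u r) (u r).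
Proof.
by move=> rd; rewrite {2}lowering_expS dot_lowering raising_lowered // dotZl.
Qed.

Lemma dot_lowered_gt0 r : (r <= d)%N -> 0 < dot (u r) (u r).
Proof.
elim: r => [_|r IHr rd]; last first.
  rewrite dot_loweredS; last exact: ltnW.
  by rewrite mulr_gt0 ?IHr 1?ltnW // exprn_gt0 // qcoef_gt0 //; lia.
rewrite expr0 mul1mx lt_def dot_ge0 andbT.
by apply: contraNneq hwvec_neq0 => /dot_eq0 ->.
Qed.

(** The squared norm of J_-^(2j+1) w contains the factor [0] = 0, and [dot] is definite. *)
Lemma lowered_eq0 : u d.+1 = 0.
Proof.
apply: dot_eq0; rewrite dot_loweredS //.
have -> : d.+1%:Z = d%:Z + 1 by lia.
by rewrite qcoef_last expr0n mul0r.
Qed.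

Lemma norm_loweredS r : (r < d)%N ->
  Num.sqrt (dot (u r.+1) (u r.+1))
  = qcoef q d r.+1 * Num.sqrt (dot (u r) (u r)).
Proof.
move=> rd; rewrite dot_loweredS; last exact: ltnW.
by rewrite sqrtrM ?sqr_ge0 // sqrtr_sqr ger0_norm // sqrtr_ge0.
Qed.

Lemma lowering_cgvec l : (l <= d)%N ->
  Jm *m cgvec d1 d2 d l = qcoef q d l *: cgvec d1 d2 d l.-1.
Proof.
case: l => [_|l ld].
  by rewrite /cgvec subn0 qcoef0 scale0r -scalemxAr -lowering_expS lowered_eq0
             scaler0.
rewrite /cgvec -scalemxAr -lowering_expS scalerA -subSn //= subSS.
have -> : (d - l)%N = (d - l.+1).+1 by lia.
rewrite norm_loweredS; last lia.
(* The ratio of norms is indexed by the number of lowerings from the top; [qcoef_rev] converts it to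
   the magnetic index. *)
have -> : (d - l.+1).+1%:Z = d%:Z + 1 - l.+1%:Z by lia.
rewrite qcoef_rev invfM mulrA divff ?mul1r // gt_eqF // qcoef_gt0 //; lia.
Qed.

Lemma raising_cgvec l : (l <= d)%N ->
  Jp *m cgvec d1 d2 d l = qcoef q d l.+1 *: cgvec d1 d2 d l.+1.
Proof.
rewrite leq_eqVlt => /predU1P[->|ld].
  rewrite /cgvec subnn -scalemxAr expr0 mul1mx raising_hwvec scaler0.
  have -> : d.+1%:Z = d%:Z + 1 by lia.
  by rewrite qcoef_last scale0r.
rewrite /cgvec -scalemxAr raising_lowered; last lia.
have -> : (d - l)%N = (d - l.+1).+1 by lia.
rewrite norm_loweredS /=; last lia.
rewrite !scalerA; congr (_ *: _).
have -> : (d - l.+1).+1%:Z = d%:Z + 1 - l.+1%:Z by lia.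
rewrite qcoef_rev invfM.
have /lt0r_neq0 : 0 < qcoef q d l.+1 by rewrite qcoef_gt0 //; lia.
set a := qcoef _ _ _; set b := (Num.sqrt _)^-1.
by move: a b => a b a0; field.
Qed.

Lemma has_weight_cgvec l : (l <= d)%N ->
  has_weight (cgvec d1 d2 d l) (t%:Z - d%:Z + l%:Z).
Proof.
move=> ld; apply: has_weightZ.
have -> : t%:Z - d%:Z + l%:Z = t%:Z - (d - l)%N%:Z by lia.
exact: has_weight_lowering_exp has_weight_hwvec.
Qed.

Lemma dot_cgvec l : (l <= d)%N -> dot (cgvec d1 d2 d l) (cgvec d1 d2 d l) = 1.
Proof.
move=> ld; rewrite /cgvec dotZl dotZr mulrA -expr2 exprVn sqr_sqrtr ?dot_ge0 //.
by rewrite mulVf // gt_eqF // dot_lowered_gt0 // leq_subr.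
Qed.

Lemma cgR_norm (l : 'I_d.+1) :
  \sum_(x < d1.+1) \sum_(y < d2.+1) cgR d1 d2 d x y l ^+ 2 = 1.
Proof.
have ld : (l <= d)%N by rewrite -ltnS.
rewrite -(dot_cgvec ld) /dot sum_mxtens; apply: eq_bigr => x _.
by apply: eq_bigr => y _; rewrite /cgR lez_nat ld /= tcoord_ord expr2.
Qed.

Lemma cgR_top_gt0 : 0 < cgR d1 d2 d d1 (t%:Z - d1%:Z) d.
Proof.
rewrite /cgR lez_nat leqnn /= /cgvec subnn expr0 mul1mx tcoordZ -dot_hwvec.
have := dot_lowered_gt0 (leq0n d); rewrite expr0 mul1mx => ww.
by rewrite mulr_gt0 // invr_gt0 sqrtr_gt0.
Qed.

End RealCG.

(* A family X of reals indexed by the shifted magnetic numbers (m1, m2, m) is an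
   intertwiner when |jm> |-> sum X |j1 m1>|j2 m2> commutes with J_0, J_-, J_+.
   Here t = j1 + j2 + j. *)
Definition intertwiner (R : realType) (q : R) (d1 d2 d t : nat)
    (X : int -> int -> int -> R) :=
  [/\ forall i k l, [|| ~~ (0 <= i <= d1%:Z), ~~ (0 <= k <= d2%:Z),
        ~~ (0 <= l <= d%:Z) | i + k + d%:Z != l + t%:Z] -> X i k l = 0,
      forall i k l, qcoef q d (l + 1) * X i k l
        = qwt q d2 k * qcoef q d1 (i + 1) * X (i + 1) k (l + 1)
          + (qwt q d1 i)^-1 * qcoef q d2 (k + 1) * X i (k + 1) (l + 1)
    & forall i k l, qcoef q d l * X i k l
        = qwt q d2 k * qcoef q d1 i * X (i - 1) k (l - 1)
          + (qwt q d1 i)^-1 * qcoef q d2 k * X i (k - 1) (l - 1)].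

Section Intertwiner.
Variables (R : realType) (q : R).
Hypotheses (q_gt0 : 0 < q) (q_neq1 : q != 1).
Variables d1 d2 d t : nat.
Hypotheses (tE : (d1 + d2 + d = t.*2)%N) (d1t : (d1 <= t)%N) (d2t : (d2 <= t)%N)
  (dt : (d <= t)%N).

Lemma cgR_intertwiner : intertwiner q d1 d2 d t (cgR q d1 d2 d).
Proof.
split=> i k l.
- rewrite /cgR; case: (boolP (0 <= l <= d%:Z)) => // l_in out.
  have [L lE Ld] : exists2 L : nat, l = L%:Z & (L <= d)%N.
    by exists `|l|%N; lia.
  move: out; rewrite lE /= => out.
  have [ik|ik] := eqVneq (i + k) (t%:Z - d%:Z + L%:Z).
    by rewrite tcoord_out //; lia.
  exact: has_weight_cgvec ik.
- have [l_in|l_out] := boolP (0 <= l + 1 <= d%:Z); last first.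
    rewrite /cgR (negPf l_out) !mulr0 addr0.
    (* Here l + 1 is out of range. At l = d the coefficient on the left may be nonzero, but its
       factor vanishes. *)
    have [->|l_neq] := eqVneq l d%:Z; first by rewrite qcoef_last mul0r.
    by rewrite ifN ?mulr0 //; lia.
  have [L lE Ld] : exists2 L : nat, l + 1 = L%:Z & (L <= d)%N.
    by exists (absz (l + 1)); lia.
  have -> : l = (L%:Z - 1) :> int by lia.
  rewrite /cgR subrK lez_nat Ld /= -tcoord_lowering // (lowering_cgvec q_gt0 q_neq1 tE) //.
  rewrite tcoordZ; case: (L) Ld => [|n] nd; first by rewrite qcoef0 !mul0r.
  have -> : n.+1%:Z - 1 = n by lia.
  by rewrite ifT //; lia.
- have [l_in|l_out] := boolP (0 <= l - 1 <= d%:Z); last first.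
    rewrite /cgR (negPf l_out) !mulr0 addr0.
    have [->|l_neq] := eqVneq l 0; first by rewrite qcoef0 mul0r.
    by rewrite ifN ?mulr0 //; lia.
  have [L lE Ld] : exists2 L : nat, l - 1 = L%:Z & (L <= d)%N.
    by exists (absz (l - 1)); lia.
  have -> : l = L.+1%:Z :> int by lia.
  have -> : L.+1%:Z - 1 = L by lia.
  rewrite /cgR !lez_nat Ld /= -tcoord_raising // (raising_cgvec q_gt0 q_neq1 tE) //.
  rewrite tcoordZ; move: Ld; rewrite leq_eqVlt => /predU1P[->|->] //.
  have -> : d.+1%:Z = d%:Z + 1 by lia.
  by rewrite qcoef_last !mul0r.
Qed.

End Intertwiner.

(** * Uniqueness of intertwiners and duality *)

Section Uniqueness.
Variables (R : realType) (q : R).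
Hypotheses (q_gt0 : 0 < q) (q_neq1 : q != 1).
Variables d1 d2 d t : nat.
Hypotheses (tE : (d1 + d2 + d = t.*2)%N) (d1t : (d1 <= t)%N) (d2t : (d2 <= t)%N)
  (dt : (d <= t)%N).
Implicit Types X Y : int -> int -> int -> R.

Lemma intertwiner_eq0 X : intertwiner q d1 d2 d t X ->
  X d1 (t%:Z - d1%:Z) d = 0 -> forall i k l, X i k l = 0.
Proof.
move=> [supp low rai] X0.
have top (n : nat) : X (d1%:Z - n%:Z) (t%:Z - d1%:Z + n%:Z) d = 0.
  elim: n => [|n IHn]; first by rewrite subr0 addr0.
  have [nd|nd] := leqP d1 n; first by rewrite supp //; lia.
  (* At l = d + 1 the left side vanishes, so the recurrence reads J_+|jj> = 0 and links the entries
     at m1 and m1 - 1. *)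
  have := rai (d1%:Z - n%:Z) (t%:Z - d1%:Z + n%:Z + 1) (d%:Z + 1).
  rewrite !addrK IHn qcoef_last mul0r mulr0 addr0 => /esym/eqP.
  rewrite !mulf_eq0 gt_eqF ?qwt_gt0 // gt_eqF ?qcoef_gt0 //=; [|lia..].
  have -> : d1%:Z - n%:Z - 1 = d1%:Z - n.+1%:Z by lia.
  have -> : t%:Z - d1%:Z + n%:Z + 1 = t%:Z - d1%:Z + n.+1%:Z by lia.
  by move/eqP.
have all (n : nat) : forall i k, X i k (d%:Z - n%:Z) = 0.
  elim: n => [|n IHn] i k.
    rewrite subr0; have [/andP[i_in /eqP ik]|out] :=
      boolP ((0 <= i <= d1%:Z) && (i + k == t%:Z)); last by rewrite supp //; lia.
    have -> : i = d1%:Z - (absz (d1%:Z - i))%:Z by lia.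
    have -> : k = t%:Z - d1%:Z + (absz (d1%:Z - i))%:Z by lia.
    exact: top.
  have [nd|nd] := leqP d n; first by rewrite supp //; lia.
  have := low i k (d%:Z - n.+1%:Z).
  have -> : d%:Z - n.+1%:Z + 1 = d%:Z - n%:Z by lia.
  rewrite !IHn !mulr0 addr0 => /eqP.
  by rewrite mulf_eq0 gt_eqF ?qcoef_gt0 //=; [move/eqP|lia..].
move=> i k l; have [l_le|l_gt] := boolP (l <= d%:Z).
  have -> : l = d%:Z - (absz (d%:Z - l))%:Z by lia.
  exact: all.
by rewrite supp //; lia.
Qed.

Lemma intertwiner_lincomb a b X Y :
  intertwiner q d1 d2 d t X -> intertwiner q d1 d2 d t Y ->
  intertwiner q d1 d2 d t (fun i k l => a * X i k l + b * Y i k l).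
Proof.
move=> [Xs Xl Xr] [Ys Yl Yr]; split=> i k l.
- by move=> out; rewrite Xs // Ys // !mulr0 addr0.
- by rewrite mulrDr !(mulrCA (qcoef q d _)) Xl Yl; ring.
- by rewrite mulrDr !(mulrCA (qcoef q d _)) Xr Yr; ring.
Qed.

(** The combination Y0 X - X0 Y is an intertwiner that vanishes at the extremal entry. *)
Lemma intertwiner_proportional X Y (X0 := X d1 (t%:Z - d1%:Z) d)
    (Y0 := Y d1 (t%:Z - d1%:Z) d) i k l :
  intertwiner q d1 d2 d t X -> intertwiner q d1 d2 d t Y ->
  Y0 * X i k l = X0 * Y i k l.
Proof.
move=> Xint Yint; apply/eqP; rewrite -subr_eq0 -mulNr; apply/eqP.
apply: (intertwiner_eq0 (intertwiner_lincomb Y0 (- X0) Xint Yint)).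
by rewrite -/X0 -/Y0; ring.
Qed.

(** At m1 = j1 the first term of the lowering recurrence drops out, so positivity spreads from m = j
    down to m2 = -j2. That last entry is the one that becomes extremal in a dual family. *)
Lemma cgR_highest_gt0 n : (n <= t - d1)%N ->
  0 < cgR q d1 d2 d d1 (t%:Z - d1%:Z - n%:Z) (d%:Z - n%:Z).
Proof.
have [_ low _] := cgR_intertwiner q_gt0 q_neq1 tE d1t d2t dt.
elim: n => [_|n IHn nt]; first by rewrite !subr0; apply: cgR_top_gt0.
have := low d1 (t%:Z - d1%:Z - n.+1%:Z) (d%:Z - n.+1%:Z).
rewrite qcoef_last mulr0 mul0r add0r.
have -> : d%:Z - n.+1%:Z + 1 = d%:Z - n%:Z by lia.
have -> : t%:Z - d1%:Z - n.+1%:Z + 1 = t%:Z - d1%:Z - n%:Z by lia.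
have lo : 0 < qcoef q d (d%:Z - n%:Z) by rewrite qcoef_gt0 //; lia.
rewrite -(pmulr_rgt0 _ lo) => ->.
by rewrite !mulr_gt0 ?invr_gt0 ?qwt_gt0 ?qcoef_gt0 ?IHn //; lia.
Qed.

(** Proportionality leaves one positive constant c to find. The normalization of [Y] at fixed m2 is
    weighted by q^(-2 m1) to offset the factor q^(m1) of the dual families; it determines c^2. *)
Lemma cgR_eq_intertwiner Y : intertwiner q d1 d2 d t Y ->
  0 < Y d1 (t%:Z - d1%:Z) d ->
  (forall k : 'I_d2.+1, \sum_(x < d1.+1) \sum_(z < d.+1)
     (qwt q d1 x) ^- 2 * Y x k z ^+ 2 = 1) ->
  forall i k l, cgR q d1 d2 d i k l =
    Num.sqrt (qnum q d.+1%:R / qnum q d2.+1%:R) * Y i k l.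
Proof.
move=> Yint Y0_gt0 Ynorm.
have Xint := cgR_intertwiner q_gt0 q_neq1 tE d1t d2t dt.
have := cgR_top_gt0 q_gt0 q_neq1 tE d1t d2t dt.
have prop i k l := intertwiner_proportional i k l Xint Yint.
set X0 := cgR _ _ _ _ _ _ _ in prop *; set Y0 := Y _ _ _ in prop Y0_gt0 * => X0_gt0.
have [c c_gt0 XE] : exists2 c, 0 < c &
    forall i k l, cgR q d1 d2 d i k l = c * Y i k l.
  exists (X0 / Y0) => [|i k l]; first exact: divr_gt0.
  apply: (mulfI (lt0r_neq0 Y0_gt0)); rewrite prop mulrA mulrCA divff ?mulr1 //.
  by rewrite gt_eqF.
suff c2 : c ^+ 2 * qnum q d2.+1%:R = qnum q d.+1%:R.
  move=> i k l; rewrite XE -c2 mulfK; last by rewrite gt_eqF ?qnum_gt0.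
  by rewrite sqrtr_sqr gtr0_norm.
(* Both sides are the sum over m1, m2, m of q^(-2m) times the squared
   coefficients: Y is normalized for each m2, the coefficients for each m. *)
transitivity (\sum_(z < d.+1) \sum_(x < d1.+1) \sum_(y < d2.+1)
    (qwt q d z) ^- 2 * cgR q d1 d2 d x y z ^+ 2); last first.
  rewrite -qnum_sum //=; apply: eq_bigr => z _.
  under eq_bigr => x _ do rewrite -mulr_sumr.
  by rewrite -mulr_sumr (cgR_norm q_gt0 q_neq1 tE) // mulr1.
rewrite -qnum_sum //= mulr_sumr exchange_big /=.
under [RHS]eq_bigr => x _ do rewrite exchange_big /=.
rewrite exchange_big /=; apply: eq_bigr => y _.
rewrite -[LHS]mulr1 -(Ynorm y) mulr_sumr; apply: eq_bigr => x _.
rewrite mulr_sumr; apply: eq_bigr => z _; rewrite XE [in RHS]exprMn.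
have [supp _ _] := Yint.
(* Only triples with m1 + m2 = m contribute, and there q^(-2m) splits as q^(-2 m1) q^(-2 m2). *)
have [xyz|/negPf nxyz] := eqVneq (x%:Z + y%:Z + d%:Z) (z%:Z + t%:Z); last first.
  by rewrite supp ?nxyz ?orbT // expr0n /= !mulr0.
rewrite -(qwtM (d1 := d1) (d2 := d2) (d := d) (i := x) (k := y) (l := z) q_gt0);
  last first.
  by rewrite !mulr2n; lia.
by field; rewrite !qwt_neq0.
Qed.

End Uniqueness.

(** * Dual families in base 1/q *)

Section Duality.
Variables (R : realType) (q : R).
Hypotheses (q_gt0 : 0 < q) (q_neq1 : q != 1).

Lemma qV_gt0 : 0 < q^-1. Proof. by rewrite invr_gt0. Qed.

Lemma qV_neq1 : q^-1 != 1. Proof. by rewrite invr_eq1. Qed.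

Definition dual_sign d1 (i : int) : R := (-1) ^ (d1%:Z - i) * qwt q d1 i.

Lemma dual_signD1 d1 i : dual_sign d1 (i + 1) = - (q * dual_sign d1 i).
Proof.
rewrite /dual_sign qwtD // expr1z opprD addrA expfzDr ?oppr_eq0 ?oner_eq0 //.
by rewrite exprN1 invrN1; ring.
Qed.

Lemma dual_signB1 d1 i : dual_sign d1 (i - 1) = - (q^-1 * dual_sign d1 i).
Proof.
have q0 : q != 0 by rewrite gt_eqF.
by rewrite -{2}(subrK 1 i) dual_signD1 mulrN mulKf // opprK.
Qed.

Lemma dual_sign_sqr d1 i : dual_sign d1 i ^+ 2 = qwt q d1 i ^+ 2.
Proof.
rewrite /dual_sign exprMn; case: (d1%:Z - i) => n; first by rewrite sqrr_sign mul1r.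
by rewrite NegzE -invr_expz exprVn sqrr_sign invr1 mul1r.
Qed.

Variables d1 d2 d t : nat.
Hypotheses (tE : (d1 + d2 + d = t.*2)%N) (d1t : (d1 <= t)%N) (d2t : (d2 <= t)%N)
  (dt : (d <= t)%N).
Implicit Type Z : int -> int -> int -> R.

Let qwt_weight i k l : i + k + d%:Z = l + t%:Z ->
  qwt q d l = qwt q d1 i * qwt q d2 k.
Proof.
by move=> ikl; symmetry; apply: qwtM => //; rewrite !mulr2n; lia.
Qed.

(** The raising recurrence of Z relates the same three entries as the lowering recurrence sought,
    solved for another one of them, and conversely. The sign change of [dual_sign] at each step of
    m1 accounts for the term that crosses the equality. *)
Lemma intertwiner_dual_right Z : intertwiner q^-1 d d1 d2 t Z ->
  intertwiner q d1 d2 d t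
    (fun i k l => dual_sign d1 i * Z l (d1%:Z - i) k).
Proof.
have q0 : q != 0 by rewrite gt_eqF.
move=> [supp low rai]; split=> i k l.
- by move=> out; rewrite supp ?mulr0 //; lia.
- have := rai (l + 1) (d1%:Z - i) (k + 1).
  rewrite !qcoefV // !qwtV // qwt_rev // !invrK !addrK.
  have -> : qcoef q d1 (d1%:Z - i) = qcoef q d1 (i + 1).
    by rewrite -qcoef_rev; congr qcoef; ring.
  have -> : d1%:Z - i - 1 = d1%:Z - (i + 1) by ring.
  (* The splitting q^(m+1) = q q^(m1) q^(m2) holds on the support of Z only, hence the factor Z on
     both sides. *)
  have wE : qwt q d (l + 1) * Z (l + 1) (d1%:Z - (i + 1)) k
      = q * (qwt q d1 i * qwt q d2 k) * Z (l + 1) (d1%:Z - (i + 1)) k.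
    have [ikl|ikl] := eqVneq (i + k + d%:Z) (l + t%:Z); last first.
      by rewrite supp ?mulr0 //; lia.
    by rewrite -(qwt_weight ikl) qwtD // expr1z.
  rewrite [X in _ = _ + X]mulrAC wE => e; rewrite dual_signD1.
  have w1 := qwt_neq0 q_gt0 d1 i.
  by rewrite [X in _ = _ + X]mulrACA e; field; exact: w1.
- have := low (l - 1) (d1%:Z - i) (k - 1).
  rewrite !subrK !qcoefV // !qwtV // qwt_rev // !invrK.
  have -> : qcoef q d1 (d1%:Z - i + 1) = qcoef q d1 i.
    by rewrite -qcoef_rev; congr qcoef; ring.
  have -> : d1%:Z - i + 1 = d1%:Z - (i - 1) by ring.
  have wE : qwt q d (l - 1) * Z (l - 1) (d1%:Z - (i - 1)) k
      = q^-1 * (qwt q d1 i * qwt q d2 k) * Z (l - 1) (d1%:Z - (i - 1)) k.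
    have [ikl|ikl] := eqVneq (i + k + d%:Z) (l + t%:Z); last first.
      by rewrite supp ?mulr0 //; lia.
    by rewrite -(qwt_weight ikl) qwtD // exprN1.
  rewrite [X in _ = _ + X]mulrAC wE => e; rewrite dual_signB1.
  have w1 := qwt_neq0 q_gt0 d1 i.
  by rewrite [X in _ = _ + X]mulrACA e; field; rewrite q0 w1.
Qed.

(** Negating both m and m2 exchanges source and target, so lowering corresponds to lowering and
    raising to raising. *)
Lemma intertwiner_dual_left Z : intertwiner q^-1 d1 d d2 t Z ->
  intertwiner q d1 d2 d t
    (fun i k l => dual_sign d1 i * Z i (d%:Z - l) (d2%:Z - k)).
Proof.
have q0 : q != 0 by rewrite gt_eqF.
move=> [supp low rai]; split=> i k l.
- by move=> out; rewrite supp ?mulr0 //; lia.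
- have := low i (d%:Z - (l + 1)) (d2%:Z - (k + 1)).
  rewrite !qcoefV // !qwtV // qwt_rev // !invrK.
  have -> : d%:Z - (l + 1) + 1 = d%:Z - l by ring.
  have -> : d2%:Z - (k + 1) + 1 = d2%:Z - k by ring.
  have -> : qcoef q d2 (d2%:Z - k) = qcoef q d2 (k + 1).
    by rewrite -qcoef_rev; congr qcoef; ring.
  have -> : qcoef q d (d%:Z - l) = qcoef q d (l + 1).
    by rewrite -qcoef_rev; congr qcoef; ring.
  have wE : qwt q d (l + 1) * Z (i + 1) (d%:Z - (l + 1)) (d2%:Z - k)
      = q * (qwt q d1 i * qwt q d2 k) * Z (i + 1) (d%:Z - (l + 1)) (d2%:Z - k).
    have [ikl|ikl] := eqVneq (i + k + d%:Z) (l + t%:Z); last first.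
      by rewrite supp ?mulr0 //; lia.
    by rewrite -(qwt_weight ikl) qwtD // expr1z.
  rewrite mulrAC wE => e; rewrite dual_signD1.
  have w1 := qwt_neq0 q_gt0 d1 i.
  by rewrite [X in _ = _ + X]mulrACA e; field; exact: w1.
- have := rai i (d%:Z - (l - 1)) (d2%:Z - (k - 1)).
  rewrite !qcoefV // !qwtV // qwt_rev // !invrK.
  have -> : d%:Z - (l - 1) - 1 = d%:Z - l by ring.
  have -> : d2%:Z - (k - 1) - 1 = d2%:Z - k by ring.
  have -> : qcoef q d2 (d2%:Z - (k - 1)) = qcoef q d2 k.
    by rewrite -qcoef_rev; congr qcoef; ring.
  have -> : qcoef q d (d%:Z - (l - 1)) = qcoef q d l.
    by rewrite -qcoef_rev; congr qcoef; ring.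
  have wE : qwt q d (l - 1) * Z (i - 1) (d%:Z - (l - 1)) (d2%:Z - k)
      = q^-1 * (qwt q d1 i * qwt q d2 k) * Z (i - 1) (d%:Z - (l - 1)) (d2%:Z - k).
    have [ikl|ikl] := eqVneq (i + k + d%:Z) (l + t%:Z); last first.
      by rewrite supp ?mulr0 //; lia.
    by rewrite -(qwt_weight ikl) qwtD // exprN1.
  rewrite mulrAC wE => e; rewrite dual_signB1.
  have w1 := qwt_neq0 q_gt0 d1 i.
  by rewrite [X in _ = _ + X]mulrACA e; field; rewrite q0 w1.
Qed.

Lemma dual_sign_top : dual_sign d1 d1 = qwt q d1 d1.
Proof. by rewrite /dual_sign subrr expr0z mul1r. Qed.

Lemma dual_norm_cancel (x : int) (z : R) :
  qwt q d1 x ^- 2 * (dual_sign d1 x * z) ^+ 2 = z ^+ 2.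
Proof.
by rewrite exprMn dual_sign_sqr mulKf // expf_neq0 // qwt_neq0.
Qed.

Lemma cgR_dual_right i k l :
  cgR q d1 d2 d i k l = Num.sqrt (qnum q d.+1%:R / qnum q d2.+1%:R)
    * (dual_sign d1 i * cgR q^-1 d d1 d2 l (d1%:Z - i) k).
Proof.
have tE' : (d + d1 + d2 = t.*2)%N by lia.
apply: (cgR_eq_intertwiner q_gt0 q_neq1 tE d1t d2t dt
  (Y := fun i k l => dual_sign d1 i * cgR q^-1 d d1 d2 l (d1%:Z - i) k)).
- exact/intertwiner_dual_right/(cgR_intertwiner qV_gt0 qV_neq1 tE').
- rewrite dual_sign_top mulr_gt0 ?qwt_gt0 // subrr.
  (* The extremal entry m1 = j1, m = j has second magnetic number -j1 in the dual coefficient, the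
     end point n = t - d of [cgR_highest_gt0]. *)
  have := cgR_highest_gt0 qV_gt0 qV_neq1 tE' dt d1t d2t (leqnn _).
  have -> : t%:Z - d%:Z - (t - d)%N%:Z = 0 by lia.
  by have -> : d2%:Z - (t - d)%N%:Z = t%:Z - d1%:Z by lia.
(* For fixed m2 the dual coefficients are the coordinates of the unit vector |j2 m2> in base 1/q;
   the sum over m1 is reversed since -m1 enters them. *)
- move=> k'; rewrite -(cgR_norm qV_gt0 qV_neq1 tE' dt d1t d2t k') exchange_big.
  apply: eq_bigr => z _; rewrite (reindex_inj rev_ord_inj) /=.
  apply: eq_bigr => x _; rewrite dual_norm_cancel.
  by congr (cgR _ _ _ _ _ _ _ ^+ 2); have := ltn_ord x; lia.
Qed.

Lemma cgR_dual_left i k l :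
  cgR q d1 d2 d i k l = Num.sqrt (qnum q d.+1%:R / qnum q d2.+1%:R)
    * (dual_sign d1 i * cgR q^-1 d1 d d2 i (d%:Z - l) (d2%:Z - k)).
Proof.
have tE' : (d1 + d + d2 = t.*2)%N by lia.
apply: (cgR_eq_intertwiner q_gt0 q_neq1 tE d1t d2t dt
  (Y := fun i k l => dual_sign d1 i
        * cgR q^-1 d1 d d2 i (d%:Z - l) (d2%:Z - k))).
- exact/intertwiner_dual_left/(cgR_intertwiner qV_gt0 qV_neq1 tE').
- rewrite dual_sign_top mulr_gt0 ?qwt_gt0 // subrr.
  have := cgR_highest_gt0 qV_gt0 qV_neq1 tE' d1t dt d2t (leqnn _).
  have -> : t%:Z - d1%:Z - (t - d1)%N%:Z = 0 by lia.
  by have -> : d2%:Z - (t - d1)%N%:Z = d2%:Z - (t%:Z - d1%:Z) by lia.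
- move=> k'.
  rewrite -(cgR_norm qV_gt0 qV_neq1 tE' d1t dt d2t (rev_ord k')).
  apply: eq_bigr => x _; rewrite (reindex_inj rev_ord_inj) /=.
  apply: eq_bigr => z _; rewrite dual_norm_cancel.
  congr (cgR _ _ _ _ _ _ _ ^+ 2); first by have := ltn_ord z; lia.
  by have := ltn_ord k'; lia.
Qed.

End Duality.

Lemma qnumV_sqrt_ratio (R : realType) (q : R) a b : 0 < q -> q != 1 ->
  (0 < a)%N -> (0 < b)%N ->
  Num.sqrt (qnum q^-1 a%:R / qnum q^-1 b%:R)
  = (Num.sqrt (qnum q b%:R / qnum q a%:R))^-1.
Proof.
move=> q0 q1 a0 b0; rewrite !qnumV // -invf_div sqrtrV //.
by rewrite divr_ge0 // ltW // qnum_gt0.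
Qed.

Local Open Scope complex_scope.

(** * Transfer to the complex coefficients *)

Section ComplexSymmetry.
Variables (R : realType) (q : R) (d1 d2 d : nat).
Variables (m1 : 'I_d1.+1) (m2 : 'I_d2.+1) (m : 'I_d.+1).
Hypotheses (q_gt0 : 0 < q) (q_neq1 : q != 1) (adm : admissible d1 d2 d).

(** The range of j amounts to the three triangle inequalities, and the parity condition makes j1 +
    j2 + j an integer; this form is symmetric in the spins. *)
Let adm_half : exists t : nat, [/\ (d1 + d2 + d = t.*2)%N, (d1 <= t)%N,
  (d2 <= t)%N & (d <= t)%N].
Proof.
exists (d1 + d2 + d)./2; move: adm; rewrite /admissible.
by case/andP => ? /eqP ?; split; lia.
Qed.

Let dual_sign_ord : dual_sign q d1 m1 = (-1) ^+ (d1 - m1) * q `^ (mag R m1).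
Proof.
rewrite /dual_sign /qwt /mag -pmulrn; congr (_ * _).
by rewrite subzn // -ltnS.
Qed.

Lemma cg_dual_right :
  cg q m1 m2 m =
    ((-1) ^+ (d1 - m1) * q `^ (mag R m1)
     * Num.sqrt (qnum q d.+1%:R / qnum q d2.+1%:R))%:C
    * cg q^-1 m (rev_ord m1) m2.
Proof.
have [t [tE d1t d2t dt]] := adm_half.
rewrite !cg_real ?qV_gt0 ?qV_neq1 // -rmorphM; congr (_%:C).
rewrite (cgR_dual_right q_gt0 q_neq1 tE) // dual_sign_ord mulrA.
congr (_ * _); first by rewrite mulrC.
by congr cgR; rewrite /= subSS subzn // -ltnS.
Qed.

Lemma cg_dual_left :
  cg q m1 m2 m =
    ((-1) ^+ (d1 - m1) * q `^ (mag R m1)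
     * Num.sqrt (qnum q d.+1%:R / qnum q d2.+1%:R))%:C
    * cg q^-1 m1 (rev_ord m) (rev_ord m2).
Proof.
have [t [tE d1t d2t dt]] := adm_half.
rewrite !cg_real ?qV_gt0 ?qV_neq1 // -rmorphM; congr (_%:C).
rewrite (cgR_dual_left q_gt0 q_neq1 tE) // dual_sign_ord mulrA.
congr (_ * _); first by rewrite mulrC.
by congr cgR; rewrite /= subSS subzn // -ltnS.
Qed.

End ComplexSymmetry.

Theorem mainTheorem5 (R : realType) (q : R) (d1 d2 d : nat)
    (m1 : 'I_d1.+1) (m2 : 'I_d2.+1) (m : 'I_d.+1) :
  0 < q -> q < 1 ->
  admissible d1 d2 d ->
  mag R m = mag R m1 + mag R m2 ->
  [/\ cg q m1 m2 m =
        ((-1) ^+ m2 * q `^ (- mag R m2)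
         * Num.sqrt (qnum q d.+1%:R / qnum q d1.+1%:R))%:C
        * cg q^-1 (rev_ord m2) m m1,
      cg q m1 m2 m =
        ((-1) ^+ (d1 - m1) * q `^ (mag R m1)
         * Num.sqrt (qnum q d.+1%:R / qnum q d2.+1%:R))%:C
        * cg q^-1 m (rev_ord m1) m2
    & cg q m1 m2 m =
        ((-1) ^+ (d1 - m1) * q `^ (mag R m1)
         * Num.sqrt (qnum q d.+1%:R / qnum q d2.+1%:R))%:C
        * cg q^-1 m1 (rev_ord m) (rev_ord m2)].
Proof.
move=> q_gt0 q_lt1 adm _; have q_neq1 : q != 1 by rewrite lt_eqF.
split; [|exact: cg_dual_right|exact: cg_dual_left].
(* The first relation is the inverse of the second one, applied to 1/q and to
   the coefficient on its right-hand side. *)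
have adm' : admissible d2 d d1.
  by move: adm; rewrite /admissible => /andP[? /eqP ?]; apply/andP; lia.
rewrite (cg_dual_right (rev_ord m2) m m1 (qV_gt0 q_gt0) (qV_neq1 q_neq1) adm').
rewrite invrK rev_ordK qnumV_sqrt_ratio // mulrA -rmorphM -[LHS]mul1r.
congr (_ * _); rewrite -(rmorph1 (real_complex R)); congr (_ %:C).
(* The second relation is used with j2, -m2 in place of j1, m1: its sign exponent is j2 + m2 and its
   power is (1/q)^(-m2) = q^(m2). Signs, powers and roots then cancel in pairs. *)
have -> : (d2 - rev_ord m2 = m2)%N by have := ltn_ord m2; rewrite /=; lia.
have -> : q^-1 `^ mag R (rev_ord m2) = q `^ mag R m2.
  rewrite -powR_inv1 ?ltW // -powRrM mulN1r /mag /= subSS natrB -1?ltnS //.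
  by congr (_ `^ _); rewrite /spin; lra.
have s0 : Num.sqrt (qnum q d.+1%:R / qnum q d1.+1%:R) != 0.
  by rewrite gt_eqF // sqrtr_gt0 divr_gt0 // qnum_gt0.
rewrite powRN mulrACA divff // mulr1 mulrACA -expr2 sqrr_sign mul1r.
by rewrite mulVf // gt_eqF // powR_gt0.
Qed.
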